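(* Let $q$ be an indeterminate and work in the formal power series ring $\mathbb{Z}[q^{-1}][[x,y]]$. Let $\mathcal{P}$ be the set of integer tuples $\pi=(a,b,c,d,e,f)\in\mathbb{Z}^6$ (written $\pi=[a,b,c,d,e][f]$) satisfying $$2a\ge 2b\ge c\ge 2d\ge 2e\ge 0,\qquad f\ge 0,$$ and for $\pi\in\mathcal{P}$ put $\mathbf{x}^{\pi}=x^{a+c+e}y^{b+d+f}$. Then $$\prod_{(i,j)\in\{(1,0),(0,1),(1,1),(2,1),(3,1),(3,2)\}}\frac{1-q^{-1}x^{i}y^{j}}{1-x^{i}y^{j}}\;=\;\sum_{\pi\in\mathcal{P}}\hat H(\pi)\,\mathbf{x}^{\pi},$$ where $\hat H(\pi)\in\mathbb{Z}[q^{-1}]$ is defined in the context below.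
   Context: Setting: the root system $G_2$ with short simple root $\alpha_s$ and long simple root $\alpha_l$; its positive roots are $i\alpha_s+j\alpha_l$ for $(i,j)\in\{(1,0),(0,1),(1,1),(2,1),(3,1),(3,2)\}$, and $x=\mathbf{x}^{\alpha_s}$, $y=\mathbf{x}^{\alpha_l}$, so the left side is $\prod_{\alpha>0}(1-q^{-1}\mathbf{x}^{\alpha})/(1-\mathbf{x}^{\alpha})$. The set $\mathcal{P}$ is the set of Littelmann patterns (for the reduced word $w_0=s_2s_1s_2s_1s_2s_1$, $s_1$ the long simple reflection) parametrizing the vertices of the infinite crystal $\mathcal{B}(\infty)$ of $G_2$; these patterns carry no boxing (no entry is ever boxed). Circling: in $\pi=[a,b,c,d,e][f]$, the entry $a$ is circled iff $a=b$; $b$ is circled iff $2b=c$; $c$ is circled iff $c=2d$; $d$ is circled iff $d=e$; $e$ is circled iff $e=0$; $f$ is circled iff $f=0$. For an entry $u$ set $h(u)=1$ if $u$ is circled and $h(u)=1-1/q$ if $u$ is not circled. The standard contribution is $H(\pi)=\prod_{u}h(u)$ over the six entries. A pattern is called bad middle if $c=b+d$ and $b=d+1$. Definition of $\hat H$: if $\pi$ is not bad middle, $\hat H(\pi)=H(\pi)$. If $\pi$ is bad middle, $\hat H(\pi)=\hat T\cdot h(f)$, where $\hat T$ is given by: (i) if $e=0$: $\hat T=(q^2-2q+1)/q^2$ if $a=b$ and $d>0$; $(q^3-3q^2+3q-1)/q^3$ if $b<a<c$ and $d>0$; $(q^3-3q^2+4q-2)/q^3$ if $a=c$ and $d>0$;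 $(q^3-3q^2+3q-1)/q^3$ if $a>c$ and $d>0$; $(q-1)/q$ if $a=b$ and $d=0$; $(q^2-2q+1)/q^2$ if $a>b$ and $d=0$. (ii) if $e>0$: $\hat T=(q^4-3q^3+4q^2-3q+1)/q^4$ if $a=b$ and $d>e$; $(q^5-4q^4+7q^3-7q^2+4q-1)/q^5$ if $a>b$ and $d>e$; $(q^2-2q+1)/q^2$ if $a=b$ and $d=e$; $(q^4-3q^3+4q^2-3q+1)/q^4$ if $a>b$ and $d=e$. *)

(* Defs.v *)
From HB Require Import structures.
From mathcomp Require Import all_boot all_order all_algebra.
From mathcomp Require Import boolp classical_sets cardinality fsbigop.
From mathcomp Require Import zify.

Set Implicit Arguments.
Unset Strict Implicit.
Unset Printing Implicit Defensive.

Import Order.TTheory GRing.Theory Num.Theory.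
Local Open Scope ring_scope.

(* The ring R[[x,y]]: [coef2 s m n] is the coefficient of x^m y^n in s.       *)
(* A record rather than a bare function type, so as not to meet the pointwise *)
(* ring structure on functions.                                               *)
Record fps2 (R : Type) := FPS2 { coef2 : nat -> nat -> R }.

HB.instance Definition _ (R : Type) := gen_eqMixin (fps2 R).
HB.instance Definition _ (R : Type) := gen_choiceMixin (fps2 R).

Lemma fps2P (R : Type) (s t : fps2 R) :
  (forall m n, coef2 s m n = coef2 t m n) -> s = t.
Proof.
case: s t => [s] [t] /= st; congr FPS2.
by apply/funext => m; apply/funext => n.
Qed.

Section Ring.
Variable R : comNzRingType.
Implicit Types s t u : fps2 R.

Definition fps2_zero : fps2 R := FPS2 (fun _ _ => 0).
Definition fps2_opp s : fps2 R := FPS2 (fun m n => - coef2 s m n).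
Definition fps2_add s t : fps2 R := FPS2 (fun m n => coef2 s m n + coef2 t m n).

Lemma fps2_addA : associative fps2_add.
Proof. by move=> s t u; apply: fps2P => m n /=; rewrite addrA. Qed.
Lemma fps2_addC : commutative fps2_add.
Proof. by move=> s t; apply: fps2P => m n /=; rewrite addrC. Qed.
Lemma fps2_add0 : left_id fps2_zero fps2_add.
Proof. by move=> s; apply: fps2P => m n /=; rewrite add0r. Qed.
Lemma fps2_addN : left_inverse fps2_zero fps2_opp fps2_add.
Proof. by move=> s; apply: fps2P => m n /=; rewrite addNr. Qed.

HB.instance Definition _ := GRing.isZmodule.Build (fps2 R)
  fps2_addA fps2_addC fps2_add0 fps2_addN.

Definition fps2_const (c : R) : fps2 R :=
  FPS2 (fun m n => if (m == 0%N) && (n == 0%N) then c else 0).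

Definition fps2_mul s t : fps2 R := FPS2 (fun m n =>
  \sum_(i < m.+1) \sum_(j < n.+1) coef2 s i j * coef2 t (m - i) (n - j)).

(* The ring axioms are transported from {poly {poly R}}, whose elements can   *)
(* match a series up to any given bidegree.                                   *)
Let agree M N (p : {poly {poly R}}) s :=
  forall m n, (m <= M)%N -> (n <= N)%N -> p`_m`_n = coef2 s m n.

Let trunc M N s : {poly {poly R}} :=
  \poly_(i < M.+1) \poly_(j < N.+1) coef2 s i j.

Let truncP M N s : agree M N (trunc M N s) s.
Proof. by move=> m n mM nN; rewrite coef_poly ltnS mM coef_poly ltnS nN. Qed.

Let agreeM M N p r s t :
  agree M N p s -> agree M N r t -> agree M N (p * r) (fps2_mul s t).
Proof.
move=> ps rt m n mM nN; rewrite coefM coef_sum /=; apply: eq_bigr => i _.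
rewrite coefM; apply: eq_bigr => j _.
have im : (i <= M)%N by apply: leq_trans mM; rewrite -ltnS.
have jn : (j <= N)%N by apply: leq_trans nN; rewrite -ltnS.
by rewrite ps // rt // (leq_trans (leq_subr _ _)).
Qed.

Let agreeD M N p r s t :
  agree M N p s -> agree M N r t -> agree M N (p + r) (fps2_add s t).
Proof. by move=> ps rt m n mM nN; rewrite !coefD ps // rt. Qed.

Let agree1 M N : agree M N 1 (fps2_const 1).
Proof.
move=> m n _ _; rewrite coef1 /=; case: (m == 0%N); last by rewrite coef0.
by rewrite coef1; case: (n == 0%N).
Qed.

Let agree_eq s t :
  (forall m n, exists2 p, agree m n p s & agree m n p t) -> s = t.
Proof. by move=> st; apply: fps2P => m n; have [p <- // <-] := st m n. Qed.

Lemma fps2_mulA : associative fps2_mul.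
Proof.
move=> s t u; apply: agree_eq => m n.
exists (trunc m n s * (trunc m n t * trunc m n u)).
  by do 2?apply: agreeM; exact: truncP.
by rewrite mulrA; do 2?apply: agreeM; exact: truncP.
Qed.

Lemma fps2_mulC : commutative fps2_mul.
Proof.
move=> s t; apply: agree_eq => m n; exists (trunc m n s * trunc m n t).
  by apply: agreeM; exact: truncP.
by rewrite mulrC; apply: agreeM; exact: truncP.
Qed.

Lemma fps2_mul1 : left_id (fps2_const 1) fps2_mul.
Proof.
move=> s; apply: agree_eq => m n; exists (1 * trunc m n s).
  by apply: agreeM; [exact: agree1 | exact: truncP].
by rewrite mul1r; exact: truncP.
Qed.

Lemma fps2_mulDl : left_distributive fps2_mul fps2_add.
Proof.
move=> s t u; apply: agree_eq => m n.
exists ((trunc m n s + trunc m n t) * trunc m n u).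
  by apply: agreeM; [apply: agreeD|]; exact: truncP.
by rewrite mulrDl; apply: agreeD; apply: agreeM; exact: truncP.
Qed.

Lemma fps2_1_neq0 : fps2_const 1 != 0.
Proof.
apply/eqP => /(congr1 (fun s => coef2 s 0 0)) /= /eqP.
by rewrite oner_eq0.
Qed.

HB.instance Definition _ := GRing.Zmodule_isComNzRing.Build (fps2 R)
  fps2_mulA fps2_mulC fps2_mul1 fps2_mulDl fps2_1_neq0.

Definition fps2_unit : {pred fps2 R} := fun s => `[< exists t, t * s = 1 >].

Definition fps2_inv s : fps2 R :=
  if pselect (exists t, t * s = 1) is left ex then projT1 (cid ex) else s.

Lemma fps2_mulV : {in fps2_unit, left_inverse 1 fps2_inv *%R}.
Proof.
move=> s /asboolP us; rewrite /fps2_inv; case: pselect => // ex.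
exact: projT2 (cid ex).
Qed.

Lemma fps2_unitPl s t : t * s = 1 -> fps2_unit s.
Proof. by move=> ts; apply/asboolP; exists t. Qed.

Lemma fps2_inv_out : {in [predC fps2_unit], fps2_inv =1 id}.
Proof.
move=> s /negP us; rewrite /fps2_inv; case: pselect => // ex.
by case: us; apply/asboolP.
Qed.

HB.instance Definition _ := GRing.ComNzRing_hasMulInverse.Build (fps2 R)
  fps2_mulV fps2_unitPl fps2_inv_out.

Definition fps2_X : fps2 R := FPS2 (fun m n => ((m == 1%N) && (n == 0%N))%:R).
Definition fps2_Y : fps2 R := FPS2 (fun m n => ((m == 0%N) && (n == 1%N))%:R).

Lemma fps2_coefX0 s k m n :
  coef2 s 0 0 = 0 -> (m + n < k)%N -> coef2 (s ^+ k) m n = 0.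
Proof.
move=> s0; elim: k m n => // k IHk m n lt_mn_k; rewrite exprS /=.
apply: big1 => i _; apply: big1 => j _.
have [/andP[/eqP-> /eqP->]|ij] := boolP ((i == 0%N :> nat) && (j == 0%N :> nat)).
  by rewrite s0 mul0r.
by rewrite IHk ?mulr0 //; have := ltn_ord i; have := ltn_ord j; lia.
Qed.

(* In particular the denominators 1 - x^i y^j with (i, j) <> (0, 0) are       *)
(* invertible, so dividing by them never meets the junk value of ^-1.         *)
Lemma fps2_unit_1B s : coef2 s 0 0 = 0 -> 1 - s \is a GRing.unit.
Proof.
move=> s0; pose g := FPS2 (fun m n => coef2 (\sum_(k < (m + n).+1) s ^+ k) m n).
have coefS (I : Type) (r : seq I) (F : I -> fps2 R) m n :
    coef2 (\sum_(i <- r) F i) m n = \sum_(i <- r) coef2 (F i) m n.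
  by elim/big_rec2: _ => // i x y _ <-.
have gE K m n : (m + n < K)%N -> coef2 g m n = coef2 (\sum_(k < K) s ^+ k) m n.
  move=> ltK; rewrite -(subnKC ltK) big_split_ord /= !coefS.
  by rewrite [X in _ + X]big1 ?addr0 // => i _; rewrite fps2_coefX0 //=; lia.
suff gs : (1 - s) * g = 1 by apply/unitrPr; exists g.
apply: fps2P => m n; set K := (m + n).+1.
have -> : coef2 ((1 - s) * g) m n = coef2 ((1 - s) * \sum_(k < K) s ^+ k) m n.
  apply: eq_bigr => i _; apply: eq_bigr => j _; rewrite (gE K) //.
  by rewrite /K ltnS leq_add // leq_subr.
rewrite -opprB mulNr -subrX1 opprB.
by rewrite -[LHS]/(coef2 1 m n - coef2 (s ^+ K) m n) fps2_coefX0 ?subr0.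
Qed.

(* [s] is the formal sum of the family [F] over [A]: the family is summable   *)
(* (each monomial occurs in finitely many members) and coefficients add up.   *)
(* Finiteness is required because \sum_(i \in A) is 0 on infinite supports.   *)
Definition fps2_has_sum (I : choiceType) (A : set I) (F : I -> fps2 R) s :=
  forall m n,
    finite_set [set i | A i /\ coef2 (F i) m n <> 0]%classic /\
    coef2 s m n = \sum_(i \in A) coef2 (F i) m n.

End Ring.

Arguments fps2_X {R}.
Arguments fps2_Y {R}.

(* Z[q^-1] is a polynomial ring over Z in the indeterminate q^-1. *)
Notation Zqinv := {poly int}.
Definition qinv : Zqinv := 'X.

(* (a, b, c, d, e, f) stands for the pattern [a,b,c,d,e][f]. *)
Notation pattern := (int * int * int * int * int * int)%type.

Definition patterns : set pattern := [set p |
  let: (a, b, c, d, e, f) := p in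
  [/\ 2 * a >= 2 * b, 2 * b >= c, c >= 2 * d, 2 * d >= 2 * e & 2 * e >= 0]
  /\ f >= 0]%classic.

(* On [patterns] both exponents are nonnegative. *)
Definition monomial (p : pattern) : fps2 Zqinv :=
  let: (a, b, c, d, e, f) := p in
  fps2_X ^ (a + c + e) * fps2_Y ^ (b + d + f).

Definition hfactor (circled : bool) : Zqinv :=
  if circled then 1 else 1 - qinv.

Definition Hstd (p : pattern) : Zqinv :=
  let: (a, b, c, d, e, f) := p in
  hfactor (a == b) * hfactor (2 * b == c) * hfactor (c == 2 * d) *
  hfactor (d == e) * hfactor (e == 0) * hfactor (f == 0).

Definition bad_middle (p : pattern) : bool :=
  let: (a, b, c, d, e, f) := p in (c == b + d) && (b == d + 1).

(* Each value (c_0 q^k + c_1 q^(k-1) + ... + c_k) / q^k is written            *)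
(* c_0 + c_1 q^-1 + ... + c_k q^-k. Used only for bad middle elements of      *)
(* [patterns]: there a >= b, d >= e >= 0 and c = 2d + 1, so each else branch  *)
(* is exactly the remaining case named in its comment.                        *)
Definition That (p : pattern) : Zqinv :=
  let: (a, b, c, d, e, f) := p in
  if e == 0 then
    if d > 0 then
      if a == b then 1 - 2 * qinv + qinv ^+ 2
      else if (b < a) && (a < c) then
        1 - 3 * qinv + 3 * qinv ^+ 2 - qinv ^+ 3
      else if a == c then 1 - 3 * qinv + 4 * qinv ^+ 2 - 2 * qinv ^+ 3
      else (* a > c *) 1 - 3 * qinv + 3 * qinv ^+ 2 - qinv ^+ 3
    else (* d = 0 *)
      if a == b then 1 - qinv
      else (* a > b *) 1 - 2 * qinv + qinv ^+ 2
  else (* e > 0 *)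
    if d > e then
      if a == b then
        1 - 3 * qinv + 4 * qinv ^+ 2 - 3 * qinv ^+ 3 + qinv ^+ 4
      else (* a > b *)
        1 - 4 * qinv + 7 * qinv ^+ 2 - 7 * qinv ^+ 3 + 4 * qinv ^+ 4
          - qinv ^+ 5
    else (* d = e *)
      if a == b then 1 - 2 * qinv + qinv ^+ 2
      else (* a > b *)
        1 - 3 * qinv + 4 * qinv ^+ 2 - 3 * qinv ^+ 3 + qinv ^+ 4.

Definition Hhat (p : pattern) : Zqinv :=
  let: (a, b, c, d, e, f) := p in
  if bad_middle p then That p * hfactor (f == 0) else Hstd p.

Definition G2_positive_roots : seq (nat * nat) :=
  [:: (1, 0); (0, 1); (1, 1); (2, 1); (3, 1); (3, 2)]%N.

(* Main.v *)
(* Put m = a - b, i = d - e, c - 2 d = 2 u + p and 2 b - c = 2 v + p with p the *)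
(* parity of c. Patterns then correspond freely to (m, i, e, p, u, v, f), and   *)
(* the monomial is a product of powers of x, x^3 y^2, x^4 y^2, x^2 y, x^3 y,    *)
(* x y and y. The standard weight H is a sum of two products of one-variable    *)
(* weights, one for each p, and the bad middle patterns are those with p = 1,   *)
(* u = v = 0. The defect of H there is again a short combination of             *)
(* product weights, plus a diagonal term m = i from the case a = c. Hence the   *)
(* sum is a combination of products of geometric series, and the theorem        *)
(* reduces to one identity of rational functions in x, y and q^-1.              *)

Require Import Defs.
From HB Require Import structures.
From mathcomp Require Import all_boot all_order all_algebra.
From mathcomp Require Import boolp classical_sets cardinality fsbigop.
From mathcomp Require Import zify ring.

Set Implicit Arguments.
Unset Strict Implicit.
Unset Printing Implicit Defensive.

Import Order.TTheory GRing.Theory Num.Theory.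
Local Open Scope ring_scope.

(** The slacks of the inequalities turn patterns into free tuples [(m, i, e, p, u, v, f)], and
    [Hhat] becomes a short combination of products of weights, each depending on one slack
    ([Hhat_slacks], [pattern_family]). Apart from one diagonal term, the sum over patterns therefore
    factors into series a + b z + b z^2 + ..., with z the monomial of a slack. Five of these
    monomials are positive roots of G2. The sixth root, x^2 y, is shared between [p], which
    contributes x^2 y at most once, and [e], which contributes its square x^4 y^2.

    Infinite sums are handled modulo high total degree: [sums_to] is stable under sums, products and
    scaling, and [sums_to_has_sum] transports the result to patterns. What then remains is
    [G2_rational_identity], an identity of fractions. *)

(** * Congruence of series modulo high total degree *)

Section Truncation.
Variable R : comNzRingType.
Implicit Types (s t : fps2 R) (K : nat).

Lemma coef2D s t m n : coef2 (s + t) m n = coef2 s m n + coef2 t m n.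
Proof. by []. Qed.

Lemma coef2_mul00 s t : coef2 (s * t) 0 0 = coef2 s 0 0 * coef2 t 0 0.
Proof. by rewrite /= !big_ord1. Qed.

Definition eq_below K s t :=
  forall m n, (m + n < K)%N -> coef2 s m n = coef2 t m n.

Lemma eq_below_trans K s t u :
  eq_below K s t -> eq_below K t u -> eq_below K s u.
Proof. by move=> st tu m n mn; rewrite st // tu. Qed.

Lemma eq_belowD K s s' t t' :
  eq_below K s s' -> eq_below K t t' -> eq_below K (s + t) (s' + t').
Proof. by move=> ss tt m n mn; rewrite !coef2D ss // tt. Qed.

Lemma eq_belowM K s s' t t' :
  eq_below K s s' -> eq_below K t t' -> eq_below K (s * t) (s' * t').
Proof.
move=> ss tt m n mn; apply: eq_bigr => i _; apply: eq_bigr => j _.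
have := ltn_ord i; have := ltn_ord j => jn im.
by rewrite ss ?tt //; lia.
Qed.

Lemma eq_below_sum0 K (I : eqType) (r : seq I) (P : pred I) (F : I -> fps2 R) :
  (forall i, P i -> eq_below K (F i) 0) -> eq_below K (\sum_(i <- r | P i) F i) 0.
Proof.
move=> F0; elim/big_rec: _ => // i s Pi s0.
by rewrite -[0]addr0; apply: eq_belowD => //; apply: F0.
Qed.

Lemma fps2_const_is_zmod_morphism : zmod_morphism (@fps2_const R).
Proof.
move=> a b; apply: fps2P => m n; rewrite coef2D /=.
by case: ifP => // _; rewrite subr0.
Qed.

Lemma fps2_const_is_monoid_morphism : monoid_morphism (@fps2_const R).
Proof.
split=> // a b; apply: fps2P => m n /=.
rewrite big_ord_recl big_ord_recl /= !subn0 big1 ?addr0; last first.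
  by move=> j _; rewrite mul0r.
rewrite big1 ?addr0; last by move=> i _; rewrite big1 // => j _; rewrite mul0r.
by case: ifP => // _; rewrite mulr0.
Qed.

HB.instance Definition _ := GRing.isZmodMorphism.Build R (fps2 R)
  (@fps2_const R) fps2_const_is_zmod_morphism.
HB.instance Definition _ := GRing.isMonoidMorphism.Build R (fps2 R)
  (@fps2_const R) fps2_const_is_monoid_morphism.

Lemma coef2_monomial00 i j : (0 < i + j)%N ->
  coef2 (fps2_X ^+ i * fps2_Y ^+ j : fps2 R) 0 0 = 0.
Proof.
case: i => [|i]; case: j => [|j] // _; rewrite ?expr0 ?mul1r ?mulr1 ?exprS.
- by rewrite coef2_mul00 mul0r.
- by rewrite coef2_mul00 mul0r.
- by rewrite -mulrA coef2_mul00 mul0r.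
Qed.

End Truncation.

(** * Calculus of summable families *)

Section Sums.
Variable R : comNzRingType.
Implicit Types (s t z : fps2 R) (K : nat).

(** Summability in the (x, y)-adic topology. The finite list may grow with [K], so each closure
    property reduces to a finite sum modulo total degree [K]. *)
Definition sums_to (I : eqType) (F : I -> fps2 R) s := forall K,
  exists r : seq I, [/\ uniq r, forall i, i \notin r -> eq_below K (F i) 0 &
    eq_below K (\sum_(i <- r) F i) s].

Lemma eq_sums_to (I : eqType) (F G : I -> fps2 R) s :
  F =1 G -> sums_to F s -> sums_to G s.
Proof. by move=> /funext ->. Qed.

Lemma eq_below_sum_sub (I : eqType) (F : I -> fps2 R) K (r r' : seq I) :
  uniq r -> uniq r' -> {subset r <= r'} ->
  (forall i, i \notin r -> eq_below K (F i) 0) ->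
  eq_below K (\sum_(i <- r') F i) (\sum_(i <- r) F i).
Proof.
move=> ur ur' rr' F0; rewrite (bigID (mem r)) /= -[X in eq_below _ _ X]addr0.
apply: eq_belowD; last exact: eq_below_sum0.
rewrite -big_filter (perm_big r) //; apply: uniq_perm; rewrite ?filter_uniq //.
by move=> i; rewrite mem_filter andb_idr //; apply: rr'.
Qed.

Lemma sums_toD (I : eqType) (F G : I -> fps2 R) s t :
  sums_to F s -> sums_to G t -> sums_to (fun i => F i + G i) (s + t).
Proof.
move=> Fs Gt K; have [r [ur F0 rs]] := Fs K; have [r' [ur' G0 rt]] := Gt K.
exists (undup (r ++ r')); split; first exact: undup_uniq.
  move=> i; rewrite mem_undup mem_cat negb_or => /andP[ir ir'].
  by rewrite -[0]addr0; apply: eq_belowD; [exact: F0 | exact: G0].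
rewrite big_split /=; apply: eq_belowD.
  apply: eq_below_trans rs; apply: eq_below_sum_sub; rewrite ?undup_uniq //.
  by move=> i ir; rewrite mem_undup mem_cat ir.
apply: eq_below_trans rt; apply: eq_below_sum_sub; rewrite ?undup_uniq //.
by move=> i ir; rewrite mem_undup mem_cat ir orbT.
Qed.

Lemma sums_toM (I J : eqType) (F : I -> fps2 R) (G : J -> fps2 R) s t :
  sums_to F s -> sums_to G t ->
  sums_to (fun ij : I * J => F ij.1 * G ij.2) (s * t).
Proof.
move=> Fs Gt K; have [r [ur F0 rs]] := Fs K; have [r' [ur' G0 rt]] := Gt K.
exists [seq (i, j) | i <- r, j <- r']; split.
- by apply: allpairs_uniq => // -[i j] [i' j'].
- case=> i j /= ij; have [ir|ir] := boolP (i \in r); last first.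
    by rewrite -(mul0r (G j)); apply: eq_belowM => //; apply: F0.
  rewrite -(mulr0 (F i)); apply: eq_belowM => //; apply: G0.
  by apply: contra ij => jr; apply/allpairsP; exists (i, j).
- by rewrite big_allpairs /= -big_distrlr /=; apply: eq_belowM.
Qed.

Lemma sums_toZ (I : eqType) (F : I -> fps2 R) s t :
  sums_to F s -> sums_to (fun i => t * F i) (t * s).
Proof.
move=> Fs K; have [r [ur F0 rs]] := Fs K; exists r; split=> // [i ir|].
  by rewrite -(mulr0 t); apply: eq_belowM => //; apply: F0.
by rewrite -big_distrr; apply: eq_belowM.
Qed.

(** Indexing by pairs lets the diagonal term [m = i] be added to product families in [m] and [i]. *)
Lemma sums_to_diag (I : eqType) (F : I -> fps2 R) s : sums_to F s ->
  sums_to (fun ij : I * I => if ij.1 == ij.2 then F ij.1 else 0) s.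
Proof.
move=> Fs K; have [r [ur F0 rs]] := Fs K.
exists [seq (i, i) | i <- r]; split.
- by rewrite map_inj_uniq // => i j [].
- move=> [i j] /=; case: eqP => [<-|//] ir; apply: F0.
  by apply: contra ir => ir; apply/mapP; exists i.
- by rewrite big_map /=; under eq_bigr do rewrite eqxx.
Qed.

Lemma sums_to_bool s t : sums_to (fun p : bool => if p then s else t) (s + t).
Proof.
move=> K; exists [:: true; false]; split=> //; first by case.
by rewrite !big_cons big_nil addr0.
Qed.

(** The pair [1], [1 - qinv] gives the factor h of an entry circled exactly when [n = 0]; the pairs
    [1 0] and [0 1] restrict to [n = 0] and to [n > 0]. *)
Definition geometric (a b : R) z (n : nat) : fps2 R :=
  fps2_const (if n == 0%N then a else b) * z ^+ n.

Lemma sums_to_geometric a b z : coef2 z 0 0 = 0 ->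
  sums_to (geometric a b z) (fps2_const (a - b) + fps2_const b / (1 - z)).
Proof.
(* As [z] has no constant term, [z ^+ n] starts in degree at least [n]. Length [K.+1] keeps the
   exceptional index 0 in the list even for [K = 0]. *)
move=> z0 K; exists (iota 0 K.+1); split; first exact: iota_uniq.
  move=> i; rewrite mem_iota /= add0n -leqNgt => Ki m n mnK.
  pose w := fps2_const (if i == 0%N then a else b).
  rewrite (eq_belowM (K := K) (s' := w) (t' := 0)) ?mulr0 //.
  by move=> m' n' mn; rewrite fps2_coefX0 //; lia.
have -> : \sum_(i <- iota 0 K.+1) geometric a b z i =
    fps2_const (a - b) + fps2_const b / (1 - z) * (1 - z ^+ K.+1).
  have -> : (1 - z ^+ K.+1) = (1 - z) * \sum_(i < K.+1) z ^+ i.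
    by rewrite -opprB subrX1 -mulNr opprB.
  rewrite -mulrA mulKr ?fps2_unit_1B // -[iota _ _]/(index_iota 0 K.+1).
  rewrite big_mkord !big_ord_recl /geometric /= !expr0 mulr1 mulrDr mulr1.
  rewrite addrA rmorphB /= subrK big_distrr; congr (_ + _).
apply: eq_belowD => //; rewrite -[X in eq_below _ _ X]mulr1.
apply: eq_belowM => // m n mn; rewrite -[RHS]subr0 coef2D; congr (_ - _).
by rewrite fps2_coefX0 //; lia.
Qed.

Lemma sums_to_has_sum (I J : choiceType) (A : set I) (phi : J -> I)
    (F : I -> fps2 R) s :
  injective phi -> (forall j, A (phi j)) ->
  (forall i, A i -> exists j, phi j = i) ->
  sums_to (fun j => F (phi j)) s -> fps2_has_sum A F s.
Proof.
move=> phiI Aphi phiA Fs m n; have [r [ur F0 rs]] := Fs (m + n).+1.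
have supp i : A i -> i \notin map phi r -> coef2 (F i) m n = 0.
  move=> /phiA[j <-] jr; apply: F0 => //; apply: contra jr.
  exact: map_f.
split.
  apply: (@sub_finite_set _ _ [set` map phi r]); last exact: finite_seq.
  move=> i [Ai Fi] /=; apply: contra_notT Fi; exact: supp.
have coefS (r' : seq J) (G : J -> fps2 R) :
    coef2 (\sum_(i <- r') G i) m n = \sum_(i <- r') coef2 (G i) m n.
  by elim/big_rec2: _ => // i x y _ <-.
rewrite -rs // coefS (fsbigE (map phi r)) ?map_inj_uniq //; last first.
  by move=> i /= /mapP[j _ ->].
rewrite big_map; apply: eq_bigl => j; apply/esym/asboolP; exact: Aphi.
Qed.
End Sums.

(** * Free coordinates on patterns and the weight in these coordinates *)

(** The nesting is the one that [sums_toM] produces in the final assembly. *)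
Definition slacks := (nat * nat * nat * (bool * (nat * nat)) * nat)%type.

Definition pattern_of_slacks (j : slacks) : pattern :=
  let: (m, i, e, (p, (u, v)), f) := j in
  let d := (e + i)%N in let b := (d + u + v + p)%N in
  (Posz (b + m), Posz b, Posz (2 * d + 2 * u + p), Posz d, Posz e, Posz f).

Lemma pattern_of_slacks_inj : injective pattern_of_slacks.
Proof.
case=> [[[[m i] e] [p [u v]]] f] [[[[m' i'] e'] [p' [u' v']]] f'] /= [].
move=> Ea Eb Ec Ed Ee Ef; have Ep : p = p' by lia.
by subst; do ![congr pair]; lia.
Qed.

Lemma pattern_of_slacksP j : patterns (pattern_of_slacks j).
Proof.
by case: j => [[[[m i] e] [p [u v]]] f]; rewrite /patterns /=; repeat split; lia.
Qed.

Lemma patterns_slacks w : patterns w -> exists j, pattern_of_slacks j = w.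
Proof.
case: w => [[[[[a b] c] d] e] f] /= [[ab bc cd de e0] f0].
(* Both [c - 2 * d] and [2 * b - c] have the parity of [c]; halving rounds down and so discards
   [p]. *)
exists (absz (a - b), absz (d - e), absz e,
  (odd (absz c), ((absz (c - 2 * d)%R)./2, (absz (2 * b - c)%R)./2)), absz f).
by rewrite /=; do ![congr pair]; lia.
Qed.

Lemma monomial_slacks m i e (p : bool) u v f :
  monomial (pattern_of_slacks (m, i, e, (p, (u, v)), f)) =
  fps2_X ^+ m * (fps2_X ^+ 3 * fps2_Y ^+ 2) ^+ i *
  (fps2_X ^+ 4 * fps2_Y ^+ 2) ^+ e * (fps2_X ^+ 2 * fps2_Y) ^+ p *
  (fps2_X ^+ 3 * fps2_Y) ^+ u * (fps2_X * fps2_Y) ^+ v * fps2_Y ^+ f.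
Proof.
rewrite /= -!PoszD -!exprnP !exprMn.
set x := fps2_X; set y := fps2_Y.
transitivity (x ^+ (m + 3 * i + 4 * e + 2 * p + 3 * u + v) *
              y ^+ (2 * i + 2 * e + p + u + v + f)).
  by congr (_ ^+ _ * _ ^+ _); lia.
by rewrite !exprD; ring.
Qed.

(* That - T on bad middle patterns, where T = H / h(f). *)
Definition correction (m i e : nat) : Zqinv :=
  if e == 0%N then
    qinv * (1 - qinv) * (hfactor (m == 0%N) * hfactor (i == 0%N))
    + qinv ^+ 2 * (1 - qinv) * ((m == i) && (0 < m)%N)%:R
  else qinv * (1 - qinv) ^+ 2 * (1 - qinv * ((0 < m)%N && (0 < i)%N)%:R).

(** If [p] holds then [c] is odd, so neither [b] nor [c] is circled. Bad middle means [u = v] and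
    [u + v + p = 1], that is [p] with [u = v = 0]. *)
Lemma Hhat_slacks m i e (p : bool) u v f :
  Hhat (pattern_of_slacks (m, i, e, (p, (u, v)), f)) =
  (hfactor (m == 0%N) * hfactor (i == 0%N) * hfactor (e == 0%N) *
    (if p then (1 - qinv) ^+ 2 else hfactor (u == 0%N) * hfactor (v == 0%N))
   + correction m i e * (p && (u == 0%N) && (v == 0%N))%:R)
  * hfactor (f == 0%N).
Proof.
rewrite /Hhat; set w := pattern_of_slacks _.
have -> : bad_middle w = p && (u == 0%N) && (v == 0%N) by rewrite /w /=; lia.
rewrite {}/w /=.
have -> : (Posz f == 0) = (f == 0%N) by lia.
have -> : (Posz e == 0) = (e == 0%N) by lia.
have -> : (Posz (e + i) == Posz e) = (i == 0%N) by lia.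
have -> : (Posz (e + i + u + v + p + m) == Posz (e + i + u + v + p)) =
    (m == 0%N) by lia.
case: ifP => [/andP[/andP[pT /eqP u0] /eqP v0]|_].
  rewrite pT u0 v0 /correction /hfactor; congr (_ * _).
  have -> : (Posz (e + i) > 0) = (0 < e + i)%N by lia.
  have -> : (Posz (e + i) > Posz e) = (0 < i)%N by lia.
  have -> : (Posz (e + i + 0 + 0 + true) < Posz (e + i + 0 + 0 + true + m)) =
      (0 < m)%N by lia.
  have -> : (Posz (e + i + 0 + 0 + true + m) < Posz (2 * (e + i) + 2 * 0 + true)) =
      (m < e + i)%N by lia.
  have -> : (Posz (e + i + 0 + 0 + true + m) == Posz (2 * (e + i) + 2 * 0 + true)) =
      (m == e + i)%N by lia.
  case: e => [|e] /=; case: i => [|i] /=; case: m => [|m] /=; try by ring.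
  (* What is left is [e = 0] with both slacks positive; there [a] compares to [c] as [m] to [i]. *)
  rewrite !add0n; case: ltngtP => /= _; ring.
have -> : (2 * Posz (e + i + u + v + p) == Posz (2 * (e + i) + 2 * u + p)) =
    ~~ p && (v == 0%N) by lia.
have -> : (Posz (2 * (e + i) + 2 * u + p) == 2 * Posz (e + i)) =
    ~~ p && (u == 0%N) by lia.
by rewrite mulr0 addr0; congr (_ * _); case: p; rewrite /hfactor /=; ring.
Qed.

(** The two cases of [correction] are separated by [geometric 1 0] and [geometric 0 1] in [e]; the
    condition that [m] and [i] are both positive is itself a product of two restrictions. *)
Lemma pattern_family m i e (p : bool) u v f (x := fps2_X) (y := fps2_Y)
    (C := @fps2_const Zqinv) (h := 1 - qinv) :
  fps2_const (Hhat (pattern_of_slacks (m, i, e, (p, (u, v)), f))) *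
    monomial (pattern_of_slacks (m, i, e, (p, (u, v)), f)) =
  (geometric 1 h x m * geometric 1 h (x ^+ 3 * y ^+ 2) i *
     geometric 1 h (x ^+ 4 * y ^+ 2) e *
     ((if p then 0 else 1) *
        (geometric 1 h (x ^+ 3 * y) u * geometric 1 h (x * y) v) +
      (if p then C h ^+ 2 * (x ^+ 2 * y) else 0) *
        (geometric 1 1 (x ^+ 3 * y) u * geometric 1 1 (x * y) v)) +
   ((C (qinv * h) * (geometric 1 h x m * geometric 1 h (x ^+ 3 * y ^+ 2) i) +
     C (qinv ^+ 2 * h) *
       (if m == i then geometric 0 1 (x * (x ^+ 3 * y ^+ 2)) m else 0)) *
      geometric 1 0 (x ^+ 4 * y ^+ 2) e +
    (C (qinv * h ^+ 2) * (geometric 1 1 x m * geometric 1 1 (x ^+ 3 * y ^+ 2) i) +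
     C (- (qinv ^+ 2 * h ^+ 2)) *
       (geometric 0 1 x m * geometric 0 1 (x ^+ 3 * y ^+ 2) i)) *
      geometric 0 1 (x ^+ 4 * y ^+ 2) e) *
    ((if p then x ^+ 2 * y else 0) *
      (geometric 1 0 (x ^+ 3 * y) u * geometric 1 0 (x * y) v))) *
  geometric 1 h y f.
Proof.
rewrite Hhat_slacks monomial_slacks -/x -/y /geometric /hfactor /correction.
rewrite [(x * (_ * _)) ^+ m]exprMn /C -/h !lt0n.
have [<-|mi] := eqVneq m i.
  (* With the powers made opaque, only the vanishing of each index matters, which leaves finitely
     many cases. *)
  move: (x ^+ m) ((_ * _) ^+ m) (_ ^+ e) (_ ^+ u) (_ ^+ v) (_ ^+ f) => Xm Xi Xe Xu Xv Xf.
  case: p; last by rewrite /= expr0; ring.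
  by case: (m == 0%N) (e == 0%N) (u == 0%N) (v == 0%N) => [] [] [] [];
    rewrite /= expr1 /h; ring.
move: (_ ^+ m) (_ ^+ i) (_ ^+ e) (_ ^+ u) (_ ^+ v) (_ ^+ f) => Xm Xi Xe Xu Xv Xf.
case: p; last by rewrite /= expr0; ring.
by case: (m == 0%N) (i == 0%N) (e == 0%N) (u == 0%N) (v == 0%N) => [] [] [] [] [];
  rewrite /= expr1 /h; ring.
Qed.

(** * The identity of rational functions *)

Lemma G2_rational_identity (R : comUnitRingType) (t x y : R)
    (gf := fun a b z : R => a - b + b / (1 - z)) (h := gf 1 (1 - t))
    (zi := x ^+ 3 * y ^+ 2) (ze := x ^+ 4 * y ^+ 2)
    (zu := x ^+ 3 * y) (zv := x * y) (zp := x ^+ 2 * y) :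
  (forall i j, (0 < i + j)%N -> 1 - x ^+ i * y ^+ j \is a GRing.unit) ->
  (h x * h zi * h ze *
     (h zu * h zv + (1 - t) ^+ 2 * zp * (gf 1 1 zu * gf 1 1 zv)) +
   (t * (1 - t) * (h x * h zi) + t ^+ 2 * (1 - t) * gf 0 1 (x * zi) +
    (t * (1 - t) ^+ 2 * (gf 1 1 x * gf 1 1 zi) -
     t ^+ 2 * (1 - t) ^+ 2 * (gf 0 1 x * gf 0 1 zi)) * gf 0 1 ze) * zp) * h y
  = \prod_(r <- G2_positive_roots)
      ((1 - t * x ^+ r.1 * y ^+ r.2) / (1 - x ^+ r.1 * y ^+ r.2)).
Proof.
move=> unit_xy; have ui : 1 - zi \is a GRing.unit by exact: unit_xy.
have ue : 1 - ze \is a GRing.unit by exact: unit_xy.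
have ux : 1 - x \is a GRing.unit by have := unit_xy 1 0; rewrite mulr1; apply.
have uy : 1 - y \is a GRing.unit by have := unit_xy 0 1; rewrite mul1r; apply.
have uu : 1 - zu \is a GRing.unit by exact: (unit_xy 3 1).
have uv : 1 - zv \is a GRing.unit by exact: (unit_xy 1 1).
have up : 1 - zp \is a GRing.unit by exact: (unit_xy 2 1).
rewrite !big_cons big_nil /= !expr0 !expr1 !mulr1 mul1r.
rewrite -!(mulrA t) -/zi -/zu -/zv -/zp.
have xzi : x * zi = ze by rewrite /zi /ze; ring.
have gfE a b z : 1 - z \is a GRing.unit -> gf a b z = (a - (a - b) * z) / (1 - z).
  by move=> uz; apply: (mulIr uz); rewrite divrK // mulrDl divrK //; ring.
(* Since [ze] is the square of [zp], the root x^2 y gets the denominator of the slack [e]. *)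
have -> : (1 - zp)^-1 = (1 + zp) / (1 - ze).
  apply: (mulrI up); rewrite divrr // mulrA; apply/esym/(canLR (mulrK ue)).
  by rewrite /zp /ze; ring.
rewrite xzi /h !gfE // {gf h gfE unit_xy}.
have /divrr := ux; have /divrr := ui; have /divrr := ue; have /divrr := uu.
have /divrr := uv; clear ux uy ui ue uu uv up xzi.
move: (1 - x)^-1 (1 - y)^-1 (1 - zi)^-1 (1 - ze)^-1 (1 - zu)^-1 (1 - zv)^-1.
move=> gx gy gi ge gu gv vK uK eK iK xK.
set T0 := (X in (X + _) * _).
set T1 := (X in (_ + (X + _ + _) * _) * _).
set T2 := (X in (_ + (_ + X + _) * _) * _).
set T3 := (X in (_ + (_ + _ + X) * _) * _).
(* Bring everything over the common denominator. *)
transitivity ((T0 +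
    (T1 * ((1 - ze) * ge) + T2 * ((1 - x) * gx) * ((1 - zi) * gi) + T3) *
    zp * ((1 - zu) * gu) * ((1 - zv) * gv)) * ((1 - t * y) * gy)).
  rewrite xK iK eK uK vK !mulr1; congr (_ * (_ * _)); ring.
(* Every term on both sides now carries the same six inverses, so they act as free variables in a
   polynomial identity. *)
rewrite /T0 /T1 /T2 /T3 /zi /ze /zu /zv /zp; ring.
Qed.

(** * Assembly of the generating function *)

Theorem theorem5p2 :
  fps2_has_sum patterns
    (fun p : pattern => fps2_const (Hhat p) * monomial p)
    (\prod_(r <- G2_positive_roots)
       ((1 - fps2_const qinv * fps2_X ^+ r.1 * fps2_Y ^+ r.2) /
        (1 - fps2_X ^+ r.1 * fps2_Y ^+ r.2))).
Proof.
apply: (sums_to_has_sum pattern_of_slacks_inj pattern_of_slacksP patterns_slacks).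
pose x : fps2 Zqinv := fps2_X; pose y : fps2 Zqinv := fps2_Y.
have mon0 i j : (0 < i + j)%N -> coef2 (x ^+ i * y ^+ j) 0 0 = 0.
  exact: coef2_monomial00.
have x0 : coef2 x 0 0 = 0 by [].
have y0 : coef2 y 0 0 = 0 by [].
have i0 : coef2 (x ^+ 3 * y ^+ 2) 0 0 = 0 by exact: mon0.
have e0 : coef2 (x ^+ 4 * y ^+ 2) 0 0 = 0 by exact: mon0.
have u0 : coef2 (x ^+ 3 * y) 0 0 = 0 by exact: (mon0 3 1).
have v0 : coef2 (x * y) 0 0 = 0 by exact: (mon0 1 1).
have p0 : coef2 (x ^+ 2 * y) 0 0 = 0 by exact: (mon0 2 1).
have xi0 : coef2 (x * (x ^+ 3 * y ^+ 2)) 0 0 = 0 by rewrite coef2_mul00 x0 mul0r.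
have := @G2_rational_identity _ (fps2_const qinv) x y => <-; last first.
  by move=> i j ij; apply/fps2_unit_1B/mon0.
pose h : Zqinv := 1 - qinv; pose C := @fps2_const Zqinv.
have hi := sums_toM (sums_to_geometric 1 h x0) (sums_to_geometric 1 h i0).
have huv := sums_toM (sums_to_geometric 1 h u0) (sums_to_geometric 1 h v0).
have guv := sums_toM (sums_to_geometric 1 1 u0) (sums_to_geometric 1 1 v0).
have duv := sums_toM (sums_to_geometric 1 0 u0) (sums_to_geometric 1 0 v0).
have gi := sums_toM (sums_to_geometric 1 1 x0) (sums_to_geometric 1 1 i0).
have pi := sums_toM (sums_to_geometric 0 1 x0) (sums_to_geometric 0 1 i0).
have di := sums_to_diag (sums_to_geometric 0 1 xi0).
have std := sums_toM (sums_toM hi (sums_to_geometric 1 h e0))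
  (sums_toD (sums_toM (sums_to_bool 0 1) huv)
            (sums_toM (sums_to_bool (C h ^+ 2 * (x ^+ 2 * y)) 0) guv)).
have cor := sums_toM
  (sums_toD
     (sums_toM (sums_toD (sums_toZ (C (qinv * h)) hi)
                         (sums_toZ (C (qinv ^+ 2 * h)) di))
        (sums_to_geometric 1 0 e0))
     (sums_toM (sums_toD (sums_toZ (C (qinv * h ^+ 2)) gi)
                         (sums_toZ (C (- (qinv ^+ 2 * h ^+ 2))) pi))
        (sums_to_geometric 0 1 e0)))
  (sums_toM (sums_to_bool (x ^+ 2 * y) 0) duv).
have total := sums_toM (sums_toD std cor) (sums_to_geometric 1 h y0).
move: total; set S := (X in sums_to _ X -> _); set T := (X in _ -> sums_to _ X).
(* The sums differ only in form: those over [p] appear as [0 + 1] or [s + 0], and scalars sit inside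
   [fps2_const]. *)
have -> : S = T by rewrite /S /T /C /h; ring.
by apply: eq_sums_to => -[[[[m i] e] [p [u v]]] f]; rewrite pattern_family.
Qed.
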